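(* Let $n,b,d$ be nonnegative integers. Then \[\sum_{k=0}^n \binom{n}{k}^2\frac{\binom{k+bn}{k}\binom{k+dn}{k}}{\binom{n+bn}{k}\binom{n+dn}{k}}\Big\{1+(n-2k)\big(2H_k-H_{bn+k}-H_{dn+k}\big)\Big\} = \frac{\binom{1+bn+dn+n}{n}}{\binom{n+bn}{n}\binom{n+dn}{n}}.\]
   Context: $H_0=0$ and $H_m=\sum_{j=1}^m \frac{1}{j}$ for positive integers $m$ (classical harmonic numbers). *)

(* Defs.v *)
From mathcomp Require Import all_boot all_order all_algebra.
Set Implicit Arguments.
Unset Strict Implicit.
Unset Printing Implicit Defensive.
Import GRing.Theory.
Local Open Scope ring_scope.

Definition harmonic_number (m : nat) : rat := \sum_(1 <= j < m.+1) j%:R^-1.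

(* Main.v *)
Require Import Defs.
From mathcomp Require Import all_boot all_order all_algebra.
From mathcomp Require Import ring.
Import GRing.Theory Num.Theory.
Local Open Scope ring_scope.

(** With [p = b n], [q = d n] and [G(x) = g_p(x) g_q(x)], where
    [g_p(x) = (x+1)...(x+p) (n-x+1)...(n-x+p)], the [k]-th coefficient on the
    left is a constant multiple of [G(k)].  Since [G(n-x) = G(x)], pairing [k]
    with [n-k] turns the left-hand side into a constant times
    [S_{p,q} = \sum_k F'(k)] for [F(x) = (n-2x) G(x)].
    Put [P = p+1], [Q = q+1] and
    [R(x) = x^2 (n+P-x) (n+Q-x) G(x)].  Then
    [R(x+1) - R(x) = (P+Q) F_{p+1,q}(x) - P^2 (n+P+Q) F_{p,q}(x)]
    and [R] has double zeros at [0] and [n+1], so differentiating and summing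
    over [k] gives [(P+Q) S_{p+1,q} = P^2 (n+P+Q) S_{p,q}]. *)

Definition sym_rising (n p : nat) : {poly rat} :=
  \prod_(1 <= i < p.+1) (('X + i%:R) * ((n + i)%:R - 'X)).

Lemma sym_rising0 n : sym_rising n 0 = 1.
Proof. by rewrite /sym_rising big_geq. Qed.

Lemma sym_risingS n p :
  sym_rising n p.+1 =
  sym_rising n p * (('X + p.+1%:R) * ((n + p.+1)%:R - 'X)).
Proof. by rewrite /sym_rising big_nat_recr. Qed.

Lemma harmonic_numberS m :
  harmonic_number m.+1 = harmonic_number m + m.+1%:R^-1.
Proof. by rewrite /harmonic_number big_nat_recr. Qed.

Lemma fact_neq0 (m : nat) : m`!%:R != 0 :> rat.
Proof. by rewrite pnatr_eq0 -lt0n fact_gt0. Qed.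

Lemma natr_factS (m : nat) : m.+1`!%:R = m.+1%:R * m`!%:R :> rat.
Proof. by rewrite factS natrM. Qed.

Lemma bin_addE (a c : nat) :
  'C(a + c, a)%:R = (a + c)`!%:R / (a`!%:R * c`!%:R) :> rat.
Proof.
rewrite -(bin_fact (leq_addr c a)) addKn !natrM mulfK //.
by rewrite mulf_neq0 // fact_neq0.
Qed.

Lemma horner_natr (m : nat) (x : rat) : (m%:R : {poly rat}).[x] = m%:R.
Proof. by rewrite -polyC_natr hornerC. Qed.

Lemma deriv_natr (m : nat) : (m%:R : {poly rat})^`() = 0.
Proof. by rewrite -polyC_natr derivC. Qed.

Lemma comp_natr (m : nat) (r : {poly rat}) : (m%:R : {poly rat}) \Po r = m%:R.
Proof. by rewrite -polyC_natr comp_polyC. Qed.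

(** The numeral rules come first: [2%:R] would otherwise be unfolded into [1 + 1]. *)
Definition dE := (deriv_natr, derivM, derivB, derivD, derivX).
Definition hE := (horner_natr, hornerC, hornerM, hornerD, hornerN, hornerX).

(** Writing [n] as [k + j] makes both runs of factors rising products, from [k] and from [j],
    without truncated subtraction. *)
Lemma horner_sym_rising k j p :
  (sym_rising (k + j) p).[k%:R] * (k`!%:R * j`!%:R) = (k + p)`!%:R * (j + p)`!%:R.
Proof.
elim: p => [|p IH]; first by rewrite sym_rising0 hornerC !addn0 mul1r.
rewrite sym_risingS !addnS !factS !natrM.
transitivity ((sym_rising (k + j) p).[k%:R] * (k`!%:R * j`!%:R)
   * ((k + p).+1%:R * (j + p).+1%:R)); last by rewrite IH; ring.
rewrite !hE; ring.
Qed.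

(** Logarithmic derivative at [k]: the factors with index [i] contribute [1/(k+i)] and [-1/(j+i)].
    This is where harmonic numbers enter. *)
Lemma horner_deriv_sym_rising k j p :
  (sym_rising (k + j) p)^`().[k%:R] =
  (sym_rising (k + j) p).[k%:R]
  * ((harmonic_number (k + p) - harmonic_number k)
     - (harmonic_number (j + p) - harmonic_number j)).
Proof.
elim: p => [|p IH]; first by rewrite sym_rising0 !addn0 derivC !hornerC; ring.
rewrite sym_risingS !addnS !harmonic_numberS !dE !hE IH.
field.
by rewrite -!natrD !nat1r !pnatr_eq0.
Qed.

(** Under [x -> x+1] both runs of consecutive factors slide by one, so only their end factors
    change; cross-multiplying them keeps the identity polynomial. *)
Lemma sym_rising_shift n p :
  (sym_rising n p \Po ('X + 1)) * (('X + 1) * ((n + p)%:R - 'X))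
  = sym_rising n p * (('X + p.+1%:R) * (n%:R - 'X)).
Proof.
elim: p => [|p IH].
  by rewrite sym_rising0 addn0 -polyC1 comp_polyC polyC1.
rewrite sym_risingS !(comp_polyM, comp_polyB, comp_polyD, comp_polyX, comp_natr).
transitivity ((sym_rising n p \Po ('X + 1)) * (('X + 1) * ((n + p)%:R - 'X))
   * (('X + p.+2%:R) * ((n + p.+1)%:R - 'X))); last by rewrite IH; ring.
ring.
Qed.

Definition summand (n p q : nat) : {poly rat} :=
  (n%:R - 2%:R * 'X) * (sym_rising n p * sym_rising n q).

Definition deriv_sum (n p q : nat) : rat :=
  \sum_(0 <= k < n.+1) (summand n p q)^`().[k%:R].

Lemma deriv_sumC n p q : deriv_sum n p q = deriv_sum n q p.
Proof. by rewrite /deriv_sum /summand [sym_rising n p * _]mulrC. Qed.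

Definition certificate (n p q : nat) : {poly rat} :=
  'X * 'X * ((n + p.+1)%:R - 'X) * ((n + q.+1)%:R - 'X)
  * (sym_rising n p * sym_rising n q).

(** The shifted prefactor of [certificate] supplies exactly the multipliers that [sym_rising_shift]
    requires for [p] and for [q]. *)
Lemma certificate_shift n p q :
  certificate n p q \Po ('X + 1) =
  ('X + p.+1%:R) * ('X + q.+1%:R) * (n%:R - 'X) * (n%:R - 'X)
  * (sym_rising n p * sym_rising n q).
Proof.
rewrite /certificate !(comp_polyM, comp_polyB, comp_polyD, comp_polyX, comp_natr).
transitivity ((sym_rising n p \Po ('X + 1)) * (('X + 1) * ((n + p)%:R - 'X))
  * ((sym_rising n q \Po ('X + 1)) * (('X + 1) * ((n + q)%:R - 'X)))).
  ring.
rewrite !sym_rising_shift; ring.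
Qed.

Lemma certificate_diff n p q :
  certificate n p q \Po ('X + 1) - certificate n p q =
  (p.+1 + q.+1)%:R * summand n p.+1 q
  - (p.+1 ^ 2 * (n + p.+1 + q.+1))%:R * summand n p q.
Proof.
rewrite certificate_shift /certificate /summand sym_risingS; ring.
Qed.

Lemma deriv_sumS n p q :
  (p.+1 + q.+1)%:R * deriv_sum n p.+1 q =
  (p.+1 ^ 2 * (n + p.+1 + q.+1))%:R * deriv_sum n p q.
Proof.
pose r := (certificate n p q)^`().
have shift (k : nat) :
    (certificate n p q \Po ('X + 1))^`().[k%:R] = r.[k.+1%:R].
  rewrite deriv_comp derivD derivX derivC addr0 mulr1 horner_comp -/r.
  by rewrite hornerD hornerX hornerC natr1.
have r0 : r.[0%:R] = 0 by rewrite /r /certificate !dE !hE; ring.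
(* The double zero at [n+1] is visible after the shift, as the factor [(n - x)^2]. *)
have rn : r.[n.+1%:R] = 0.
  by rewrite -shift certificate_shift !dE !hE; ring.
apply/eqP; rewrite -subr_eq0 /deriv_sum !mulr_sumr -sumrB; apply/eqP.
transitivity (\sum_(0 <= k < n.+1) (r.[k.+1%:R] - r.[k%:R])).
  apply: eq_bigr => k _.
  rewrite -shift -hornerN -hornerD -derivB certificate_diff.
  by rewrite !dE !hE; ring.
by rewrite (telescope_sumr (fun k => r.[k%:R])) // r0 rn subrr.
Qed.

(** Raising [p] multiplies the three factorials involving [p] by [P+Q], [n+P+Q] and, after squaring,
    [P^2], as in [deriv_sumS]. *)
Lemma deriv_sumE n p q :
  deriv_sum n p q * (n`!%:R * (p + q).+1`!%:R) =
  - 2 * ((p + q + n).+1`!%:R * (p`!%:R * q`!%:R) ^+ 2).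
Proof.
have step p' q' :
    deriv_sum n p' q' * (n`!%:R * (p' + q').+1`!%:R) =
      - 2 * ((p' + q' + n).+1`!%:R * (p'`!%:R * q'`!%:R) ^+ 2) ->
    deriv_sum n p'.+1 q' * (n`!%:R * (p'.+1 + q').+1`!%:R) =
      - 2 * ((p'.+1 + q' + n).+1`!%:R * (p'.+1`!%:R * q'`!%:R) ^+ 2).
  move=> IH.
  rewrite !addSn (natr_factS (p' + q').+1) (natr_factS (p' + q' + n).+1) (natr_factS p').
  transitivity ((p'.+1 + q'.+1)%:R * deriv_sum n p'.+1 q'
                * (n`!%:R * (p' + q').+1`!%:R)).
    by rewrite addSn addnS; ring.
  rewrite deriv_sumS.
  transitivity (deriv_sum n p' q' * (n`!%:R * (p' + q').+1`!%:R)
     * (p'.+1 ^ 2 * (n + p'.+1 + q'.+1))%:R); first by ring.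
  by rewrite IH; ring.
elim: p => [|p IH]; last exact: step.
elim: q => [|q IH].
  rewrite /deriv_sum.
  (* For [p = q = 0] the summand is [n - 2x], with constant derivative. *)
  rewrite (eq_bigr (fun _ => - 2)) => [|k _]; last first.
    by rewrite /summand !sym_rising0 !mulr1 !dE !hE; ring.
  by rewrite big_const_nat iter_addr_0 subn0 !add0n (natr_factS n) (natr_factS 0) fact0; ring.
(* [step] raises only the first index, so [q] is raised by symmetry. *)
rewrite deriv_sumC [(0 + _)%N]addnC.
by rewrite step; [ring | rewrite addnC deriv_sumC IH; ring].
Qed.

Lemma sym_rising_rev k j p :
  (sym_rising (k + j) p).[j%:R] = (sym_rising (k + j) p).[k%:R].
Proof.
apply: (mulIf (mulf_neq0 (fact_neq0 j) (fact_neq0 k))).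
rewrite [in LHS]addnC horner_sym_rising [j`!%:R * k`!%:R]mulrC.
by rewrite horner_sym_rising mulrC.
Qed.

Definition harmonic_sum (n p q : nat) : rat :=
  \sum_(0 <= k < n.+1)
    (sym_rising n p).[k%:R] * (sym_rising n q).[k%:R]
    * (1 + (n%:R - 2 * k%:R)
           * (2 * harmonic_number k - harmonic_number (p + k)
              - harmonic_number (q + k))).

(** The logarithmic derivative of [G] at [k] is [l (n-k) - l k]. As [n - 2k] changes sign under
    [k -> n-k], the derivative of [F] at [k] is [-2 g k - f k - f (n-k)], and reversing the sum
    merges the two [f] terms. *)
Lemma harmonic_sumE n p q : deriv_sum n p q = - 2 * harmonic_sum n p q.
Proof.
pose g (k : nat) := (sym_rising n p).[k%:R] * (sym_rising n q).[k%:R].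
pose l k := 2 * harmonic_number k - harmonic_number (p + k)
              - harmonic_number (q + k).
pose f (k : nat) := g k * ((n%:R - 2 * k%:R) * l k).
have grev k : (k <= n)%N -> g (n - k)%N = g k.
  by move=> /subnKC nE; rewrite /g -[in LHS]nE -[in RHS]nE addKn !sym_rising_rev.
have -> : harmonic_sum n p q = \sum_(0 <= k < n.+1) (g k + f k).
  by apply: eq_bigr => k _; rewrite /f /g /l; ring.
transitivity (\sum_(0 <= k < n.+1) (- 2 * g k - f k - f (n - k)%N)).
  apply: eq_big_nat => k /andP[_]; rewrite ltnS => kn.
  rewrite /f grev // /g natrB //.
  have [j nE] : exists j, n = (k + j)%N by exists (n - k)%N; rewrite subnKC.
  rewrite /summand !dE !hE nE !horner_deriv_sym_rising addKn /l.
  rewrite ![(p + _)%N]addnC ![(q + _)%N]addnC natrD; ring.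
have frev : \sum_(0 <= k < n.+1) f (n - k)%N = \sum_(0 <= k < n.+1) f k.
  by rewrite [RHS]big_nat_rev /=; apply: eq_bigr => k _; rewrite add0n subSS.
rewrite !sumrB frev big_split /= -mulr_sumr; ring.
Qed.

(** The squared binomial supplies the denominator [(k! j!)^2] of [G(k)]; the remaining prefactor
    depends only on [n = k + j], [p] and [q]. *)
Lemma coeffE k j p q :
  'C(k + j, k)%:R ^+ 2
     * ('C(k + p, k)%:R * 'C(k + q, k)%:R
        / ('C(k + j + p, k)%:R * 'C(k + j + q, k)%:R)) =
  (k + j)`!%:R ^+ 2
   / (p`!%:R * q`!%:R * ((k + j + p)`!%:R * (k + j + q)`!%:R))
  * ((sym_rising (k + j) p).[k%:R] * (sym_rising (k + j) q).[k%:R]) :> rat.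
Proof.
have symE r : (sym_rising (k + j) r).[k%:R]
    = (k + r)`!%:R * (j + r)`!%:R / (k`!%:R * j`!%:R).
  by rewrite -horner_sym_rising mulfK // mulf_neq0 // fact_neq0.
rewrite -!addnA !bin_addE !symE; field.
by rewrite !fact_neq0.
Qed.

(** Here [p] and [q] are free rather than multiples of [n], since the recurrence raises them one at
    a time with [n] fixed. *)
Lemma well_poised_harmonic n p q :
  \sum_(0 <= k < n.+1)
     'C(n, k)%:R ^+ 2
     * ('C(k + p, k)%:R * 'C(k + q, k)%:R
        / ('C(n + p, k)%:R * 'C(n + q, k)%:R))
     * (1 + (n%:R - 2 * k%:R)
            * (2 * harmonic_number k - harmonic_number (p + k)
               - harmonic_number (q + k)))
  = 'C(1 + p + q + n, n)%:R
    / ('C(n + p, n)%:R * 'C(n + q, n)%:R) :> rat.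
Proof.
transitivity (n`!%:R ^+ 2
   / (p`!%:R * q`!%:R * ((n + p)`!%:R * (n + q)`!%:R)) * harmonic_sum n p q).
  rewrite /harmonic_sum mulr_sumr; apply: eq_big_nat => k /andP[_].
  by rewrite ltnS => /subnKC nE; rewrite -nE coeffE nE !mulrA.
have -> : harmonic_sum n p q = (p + q + n).+1`!%:R * (p`!%:R * q`!%:R) ^+ 2
    / (n`!%:R * (p + q).+1`!%:R).
  apply: (canRL (mulfK _)); first by rewrite mulf_neq0 // fact_neq0.
  have two : - 2 != 0 :> rat by [].
  by apply: (mulfI two); rewrite mulrA -harmonic_sumE deriv_sumE.
rewrite -[(1 + p + q)%N]/((p + q).+1) [((p + q).+1 + n)%N]addnC !bin_addE.
rewrite addnS [(n + (p + q))%N]addnC.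
field.
by rewrite !fact_neq0.
Qed.

Theorem theorem5 (n b d : nat) :
  \sum_(0 <= k < n.+1)
     'C(n, k)%:R ^+ 2
     * ('C(k + b * n, k)%:R * 'C(k + d * n, k)%:R
        / ('C(n + b * n, k)%:R * 'C(n + d * n, k)%:R))
     * (1 + (n%:R - 2 * k%:R)
            * (2 * harmonic_number k - harmonic_number (b * n + k)
               - harmonic_number (d * n + k)))
  = 'C(1 + b * n + d * n + n, n)%:R
    / ('C(n + b * n, n)%:R * 'C(n + d * n, n)%:R) :> rat.
Proof. exact: well_poised_harmonic. Qed.
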